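(* Let $k,r$ be positive integers and $h=4$, such that $\ell=\frac{k+4}{r}$ is an integer. Let $m$ be the smallest integer such that $3\mid(m-1)$ and $\ell\le 2^{r(m-1)}$. Then there exists a maximally recoverable local $(k,r,4)$-code over the field $\mathbb{F}_{2^t}$, where $t=r\left(2m+\frac{m-1}{3}\right)$.
   Context: For positive integers $k,r,h$ with $r\mid(k+h)$, a local $(k,r,h)$-code over a finite field $\mathbb{F}$ is a linear systematic code of dimension $k$ and length $k+h+\frac{k+h}{r}$ consisting of $k$ data symbols, $h$ heavy parity symbols (each a fixed $\mathbb{F}$-linear combination of all data symbols), and, after partitioning the $k+h$ data and heavy parity symbols into $\frac{k+h}{r}$ groups of size $r$, one local parity per group equal to the sum (XOR) of the group's symbols. A local group is such a group together with its local parity. The code is maximally recoverable if for every set $E$ of coordinates containing exactly one coordinate from each local group, puncturing the code in $E$ yields a maximum distance separable $[k+h,k]$ code (minimum distance $h+1$). *)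

(* Defs.v *)
From HB Require Import structures.
From mathcomp Require Import all_boot all_order all_algebra all_field.
Set Implicit Arguments. Unset Strict Implicit. Unset Printing Implicit Defensive.
Import GRing.Theory.
Local Open Scope ring_scope.

(* A local (k,r,h)-code over F with l = (k+h)/r local groups is given by
   - H : 'M[F]_(k,h): heavy parity j of message x is (x *m H) 0 j, i.e. a fixed
     linear combination of all data symbols;
   - grp : 'I_(k+h) -> 'I_l : the partition of the k+h data/heavy symbols into
     l groups (each group of size r, required separately).
   Coordinates of the code: 'I_(k+h) + 'I_l ; inl i = data (i<k) / heavy
   (i>=k) symbol, inr g = local parity of group g. *)

Section LocalCode.
Variables (F : fieldType) (k h l : nat).

Definition lc_sym (H : 'M[F]_(k, h)) (x : 'rV[F]_k) : 'rV[F]_(k + h) :=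
  row_mx x (x *m H).

Definition lc_codeword (H : 'M[F]_(k, h)) (grp : 'I_(k + h) -> 'I_l)
  (x : 'rV[F]_k) (c : 'I_(k + h) + 'I_l) : F :=
  match c with
  | inl i => lc_sym H x 0 i
  | inr g => \sum_(i | grp i == g) lc_sym H x 0 i
  end.

Definition in_local_group (grp : 'I_(k + h) -> 'I_l) (g : 'I_l)
  (c : 'I_(k + h) + 'I_l) : bool :=
  match c with
  | inl i => grp i == g
  | inr g' => g' == g
  end.
End LocalCode.

Definition punct_weight (F : finFieldType) (k h l : nat) (H : 'M[F]_(k, h))
  (grp : 'I_(k + h) -> 'I_l) (E : {set ('I_(k + h) + 'I_l)}) (x : 'rV[F]_k) : nat :=
  #|[set c | (c \notin E) && (lc_codeword H grp x c != 0)]|.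

(* The punctured code (length k+h when E meets every local group exactly once)
   is an MDS [k+h,k] code: it has dimension k (the encoding x |-> punctured
   codeword is injective) and its minimum distance (minimum weight of a nonzero
   codeword) equals h+1. *)
Definition punctured_MDS (F : finFieldType) (k h l : nat) (H : 'M[F]_(k, h))
  (grp : 'I_(k + h) -> 'I_l) (E : {set ('I_(k + h) + 'I_l)}) : Prop :=
  (forall x : 'rV[F]_k,
      (forall c, c \notin E -> lc_codeword H grp x c = 0) -> x = 0)
  /\ (forall x : 'rV[F]_k, x != 0 -> (h.+1 <= punct_weight H grp E x)%N)
  /\ (exists x : 'rV[F]_k, x != 0 /\ punct_weight H grp E x = h.+1).

Definition maximally_recoverable (F : finFieldType) (k h l : nat)
  (H : 'M[F]_(k, h)) (grp : 'I_(k + h) -> 'I_l) : Prop :=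
  forall E : {set ('I_(k + h) + 'I_l)},
    (forall g : 'I_l, #|[set c in E | in_local_group grp g c]| = 1%N) ->
    punctured_MDS H grp E.

Definition valid_grouping (k h l r : nat) (grp : 'I_(k + h) -> 'I_l) : Prop :=
  forall g : 'I_l, #|[set i | grp i == g]| = r.

(* Main.v *)
Require Import Defs.
From HB Require Import structures.
From mathcomp Require Import all_boot all_order all_algebra all_field ring zify.
Set Implicit Arguments. Unset Strict Implicit. Unset Printing Implicit Defensive.
Import GRing.Theory VectorInternalTheory.
Local Open Scope ring_scope.

(* The heavy parity checks are sum_i a_i^(2^j) x_i = 0 for j < h, with a_i in F.
   Puncturing one symbol per group replaces the a_i by their differences with
   the punctured one, so the code is maximally recoverable as soon as any h of
   these differences, over all groups, are independent over F_2 (Moore matrix).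

   Let K be the field with q = 2^r elements. The differences of a group lie in
   a K-line spanned by a point of a K-space of dimension 7s + 2 (m - 1 = 3s),
   in which the elements of the group form an F_2-basis; so l <= q^(3s) points
   are needed, any 4 of them independent over K. Take (1, x, f(x)^(q+1), N(x)),
   for x in V = F_(q^3s), where N is the norm to F_(q^s), and f embeds V into
   an extension L of K of odd degree 3s or 3s+1. If 4 distinct points with no
   vanishing coefficient satisfied the first three relations without lying on
   a K-line, a ratio z in L \ K of their differences would have its conjugate
   z^q = M z for some M in PGL_2(K) of trace 0, hence z^(q^2) = z, which is
   absurd in odd degree. On a line, N is a cubic with nonzero leading
   coefficient, and the points are independent by Vandermonde. *)

(** * Codes from Moore matrices *)

(** Nonsingularity of Moore matrices, by induction on the number [h] of relations. Subset sums
    express independence over F_2, whose coefficients are 0 and 1. *)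
Lemma moore_independent (R : fieldType) (I : finType) (h : nat)
    (T : {set I}) (d y : I -> R) :
  2%N \in [pchar R] -> (#|T| <= h)%N ->
  (forall S : {set I}, S \subset T -> \sum_(c in S) d c = 0 -> S = set0) ->
  (forall a, (a < h)%N -> \sum_(c in T) y c * d c ^+ (2 ^ a) = 0) ->
  {in T, forall c, y c = 0}.
Proof.
move=> char2; elim: h => [|h IHh] in T d y *.
  by rewrite leqn0 cards_eq0 => /eqP -> _ _ c; rewrite inE.
move=> leT indep sum0 c0 Tc0; apply/eqP/negPn/negP => yc0.
(* Squaring the a-th relation and subtracting the (a+1)-st one eliminates c0,
   and shows by induction that the z c lie in F_2. *)
pose T' := T :\ c0; pose z c := y c / y c0.
have sumz a : (a < h.+1)%N ->
    d c0 ^+ (2 ^ a) + \sum_(c in T') z c * d c ^+ (2 ^ a) = 0.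
  move=> lta; have := sum0 a lta; rewrite (big_setD1 c0) //= => e.
  have : (y c0)^-1 * (y c0 * d c0 ^+ (2 ^ a)
            + \sum_(c in T') y c * d c ^+ (2 ^ a)) = 0 by rewrite e mulr0.
  rewrite mulrDr mulKf // mulr_sumr; apply: etrans; congr (_ + _).
  by apply: eq_bigr => c _; rewrite /z mulrA [_ / _]mulrC.
have sqD (u v : R) : (u + v) ^+ 2 = u ^+ 2 + v ^+ 2.
  by rewrite exprDn_pchar // pnatE.
have sq_sum (S : {set I}) (f : I -> R) :
    (\sum_(c in S) f c) ^+ 2 = \sum_(c in S) f c ^+ 2.
  elim/big_rec2: _ => [|c u v _ <-]; last by rewrite sqD.
  by rewrite expr0n.
have z01 c : c \in T' -> z c ^+ 2 - z c = 0.
  apply: (IHh T' (fun c => d c ^+ 2) (fun c => z c ^+ 2 - z c)).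
  - by move: leT; rewrite (cardsD1 c0) Tc0.
  - move=> S sST; rewrite -sq_sum => /eqP; rewrite sqrf_eq0 => /eqP.
    by apply: indep; apply: subset_trans sST (subsetDl _ _).
  move=> a lta; have e1 := sumz a.+1 lta; have e0 := sumz a (ltnW lta).
  have : (d c0 ^+ (2 ^ a) + \sum_(c in T') z c * d c ^+ (2 ^ a)) ^+ 2
     - (d c0 ^+ (2 ^ a.+1) + \sum_(c in T') z c * d c ^+ (2 ^ a.+1)) = 0.
    by rewrite e0 e1 expr0n subr0.
  rewrite sqD sq_sum -exprM -expnSr opprD addrACA subrr add0r -sumrB.
  apply: etrans; apply: eq_bigr => c' _.
  by rewrite mulrBl [in RHS]exprMn -!exprM -expnS -expnSr.
(* As the [z c] are 0 or 1, the relation for [a = 0] says that the [d c] sum to zero over this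
   nonempty set. *)
pose S := c0 |: [set c in T' | z c != 0].
have sST : S \subset T.
  apply/subsetP => c; rewrite !inE => /orP[/eqP -> //|/andP[/andP[_ ->]] //].
have := indep _ sST; rewrite /S big_setU1 ?inE ?eqxx //= => e.
suff /e/setP/(_ c0) :
    d c0 + \sum_(c in [set c in T' | z c != 0]) d c = 0 by rewrite !inE eqxx.
have := sumz 0 isT; rewrite expr1; apply: etrans; congr (_ + _).
rewrite [RHS](bigID (fun c => z c != 0)) /= [X in _ + X]big1 ?addr0; last first.
  by move=> c /andP[_ /negPn /eqP ->]; rewrite mul0r.
apply: eq_big => [c|c]; first by rewrite !inE.
rewrite inE => /andP[Tc zc]; have /eqP := z01 c Tc.
rewrite expr2 -{3}[z c]mulr1 -mulrBr mulf_eq0 (negPf zc) subr_eq0 => /eqP ->.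
by rewrite mul1r.
Qed.

Section Code.
Variables (F : finFieldType) (k h l r : nat).
Variables (grp : 'I_(k + h) -> 'I_l) (idx : 'I_(k + h) -> 'I_r).
Variable P : 'I_l -> {additive 'rV['F_2]_r -> F}.
Hypothesis char2 : 2%N \in [pchar F].
Hypothesis grp_idx_inj : forall i j, grp i = grp j -> idx i = idx j -> i = j.
Hypothesis P_indep : forall (G : {set 'I_l}) (u : 'I_l -> 'rV['F_2]_r),
  (#|G| <= h)%N -> \sum_(g in G) P g (u g) = 0 -> {in G, forall g, u g = 0}.

Local Notation coord := ('I_(k + h) + 'I_l)%type.

Definition coord_group (c : coord) : 'I_l :=
  match c with inl i => grp i | inr g => g end.

(** With the zero vector, a local parity does not enter the heavy checks, yet takes part in the
    differences like any symbol. *)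
Definition coord_vec (c : coord) : 'rV['F_2]_r :=
  match c with inl i => delta_mx 0 (idx i) | inr _ => 0 end.

Definition coord_elt (c : coord) : F := P (coord_group c) (coord_vec c).

(** [P_indep] separates the groups. Within a group, the basis vectors of the symbols and the zero
    vector of the parity are affinely independent. *)
Lemma punctured_elts_independent (e : 'I_l -> coord) (S : {set coord}) :
  (forall g, coord_group (e g) = g) ->
  {in S, forall c, c != e (coord_group c)} -> (#|S| <= h)%N ->
  \sum_(c in S) (coord_elt c + coord_elt (e (coord_group c))) = 0 -> S = set0.
Proof.
move=> eg Se leS sum0.
pose u g := \sum_(c in S | coord_group c == g) (coord_vec c + coord_vec (e g)).
have u0 : {in coord_group @: S, forall g, u g = 0}.
  apply: P_indep; first exact: leq_trans (leq_imset_card _ _) leS.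
  rewrite -[RHS]sum0 [RHS](partition_big_imset coord_group) /=.
  apply: eq_bigr => g _; rewrite raddf_sum; apply: eq_bigr => c /andP[_ /eqP cg].
  by rewrite /coord_elt eg cg raddfD.
have uS c : c \in S -> u (coord_group c) = 0 by move=> Sc; apply/u0/imset_f.
(* Only [inl i] contributes to the coordinate [idx i], since the punctured coordinate of its group
   is another one. *)
have S_inl i : inl i \notin S.
  apply/negP => Si; have := uS _ Si; move/rowP/(_ (idx i)); rewrite [RHS]mxE => /eqP.
  have vec0 c : coord_group c = grp i -> inl i != c -> coord_vec c 0 (idx i) = 0.
    case: c => [i'|g] /= gi' ne; rewrite mxE //=.
    case: eqP => // ii'; case/eqP: ne; congr inl; exact/esym/grp_idx_inj.
  rewrite /u summxE (bigD1 (inl i)) ?Si /= ?eqxx // big1 ?addr0 => [|c].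
    by rewrite mxE [X in _ + X]vec0 ?eg ?(Se _ Si) // addr0 mxE !eqxx oner_eq0.
  move=> /andP[/andP[_ /eqP cg] ci].
  by rewrite mxE !vec0 ?addr0 ?eg ?(Se _ Si) // eq_sym.
apply/setP => c; rewrite inE; apply/negP; case: c => [i|g] Sc.
  by have := S_inl i; rewrite Sc.
(* A parity left in [S] was not punctured, so a symbol of its group was, and its basis vector
   survives in [u g]. *)
have := uS _ Sc; have := Se _ Sc; have := eg g; rewrite /u /=.
rewrite (bigD1 (inr g)) ?Sc /= ?eqxx // big1 ?addr0 ?add0r.
  case: (e g) => [i _ _|g' /= -> /eqP//] /= /rowP /(_ (idx i)) /eqP.
  by rewrite !mxE !eqxx oner_eq0.
case=> [i|g']; first by rewrite (negPf (S_inl i)).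
by rewrite /= => /andP[/andP[_ /eqP ->] /eqP].
Qed.

Definition moore_mx : 'M[F]_(k + h, h) :=
  \matrix_(i, a) coord_elt (inl i) ^+ (2 ^ a).

(** When all local parities are punctured, the differences are the elements themselves; so those of
    the heavy symbols are independent. *)
Lemma moore_mx_unit : dsubmx moore_mx \in unitmx.
Proof.
rewrite -row_free_unit; apply: inj_row_free => v v0.
pose d j := coord_elt (inl (rshift k j)).
apply/rowP => j; rewrite [RHS]mxE.
apply: (@moore_independent F _ h setT d (v 0)) => // [|S _ sum0|a lta].
- by rewrite cardsT card_ord.
- have inj_i : injective (fun j => inl (rshift k j) : coord).
    by move=> i i' eqi; apply: (@rshift_inj k h); case: eqi => eqi; exact: val_inj.
  apply/eqP; rewrite -cards_eq0 -(card_imset _ inj_i) cards_eq0; apply/eqP.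
  apply: (@punctured_elts_independent inr) => //.
  + by move=> c /imsetP[i _ ->].
  + by rewrite card_imset // (leq_trans (max_card _)) ?card_ord.
  rewrite big_imset /= => [|i i' _ _ /inj_i //]; rewrite -[RHS]sum0.
  by apply: eq_bigr => i _; rewrite [X in _ + X]raddf0 addr0.
have /rowP/(_ (Ordinal lta)) := v0; rewrite !mxE => v0a.
rewrite -[RHS]v0a big_mkcond /=; apply: eq_bigr => i _.
by rewrite inE !mxE.
Qed.

(** The parity checks given by the columns of [moore_mx], solved for the heavy symbols. *)
Definition heavy_mx : 'M[F]_(k, h) :=
  - (usubmx moore_mx *m invmx (dsubmx moore_mx)).

Local Notation word := (lc_codeword heavy_mx grp).

Lemma lc_sym_moore x : lc_sym heavy_mx x *m moore_mx = 0.
Proof.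
rewrite -[moore_mx]vsubmxK /lc_sym mul_row_col /heavy_mx mulmxN mulNmx.
by rewrite mulmxA mulmxKV ?moore_mx_unit // subrr.
Qed.

Lemma sum_group_word x g : \sum_(c | coord_group c == g) word x c = 0.
Proof.
rewrite big_sumType /= [X in _ + X](big_pred1 g) => [|g']; last by rewrite /= eq_sym.
exact: addrr_pchar2.
Qed.

Lemma sum_word_elt x a : (a < h)%N ->
  \sum_c word x c * coord_elt c ^+ (2 ^ a) = 0.
Proof.
move=> lta; rewrite big_sumType /= [X in _ + X]big1 ?addr0 => [|g _]; last first.
  by rewrite /coord_elt raddf0 expr0n expn_eq0 mulr0.
have /rowP/(_ (Ordinal lta)) := lc_sym_moore x; rewrite !mxE => {2}<-.
by apply: eq_bigr => i _; rewrite !mxE.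
Qed.

Lemma wordB x x' c : word (x - x') c = word x c - word x' c.
Proof.
have symB i : lc_sym heavy_mx (x - x') 0 i =
    lc_sym heavy_mx x 0 i - lc_sym heavy_mx x' 0 i.
  by rewrite /lc_sym mulmxBl -[row_mx (x - x') _]add_row_mx -opp_row_mx !mxE.
case: c => [i|g] //=; rewrite -sumrB; exact: eq_bigr.
Qed.

(** * Puncturing one coordinate per local group *)

Section Puncture.
Variables (E : {set coord}) (e : 'I_l -> coord).
Hypothesis eP : forall g c, (c \in E) && (coord_group c == g) = (c == e g).

Let eE g : e g \in E.
Proof. by have := eP g (e g); rewrite eqxx => /andP[]. Qed.

Let eg g : coord_group (e g) = g.
Proof. by have := eP g (e g); rewrite eqxx => /andP[_ /eqP]. Qed.

Let inE_e c : (c \in E) = (c == e (coord_group c)).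
Proof. by rewrite -eP eqxx andbT. Qed.

(** Each group sums to zero, so its punctured coordinate is recovered from the others. *)
Lemma punctured_word_inj x : (forall c, c \notin E -> word x c = 0) -> x = 0.
Proof.
move=> x0; have {}x0 c : word x c = 0.
  case: (boolP (c \in E)) => [|/x0 //]; rewrite inE_e => /eqP ->.
  move: (coord_group c) => g; have := sum_group_word x g.
  rewrite (bigD1 (e g)) ?eg //= big1 ?addr0 // => c' /andP[/eqP <- ne].
  by apply: x0; rewrite inE_e.
apply/rowP => i; have := x0 (inl (lshift h i)).
by rewrite /= /lc_sym row_mxEl => ->; rewrite mxE.
Qed.

(** A support of at most [h] coordinates would carry a relation excluded by [moore_independent], the
    differences [d] being independent. *)
Lemma punctured_word_weight x : x != 0 -> (h < punct_weight heavy_mx grp E x)%N.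
Proof.
move=> nz_x; rewrite ltnNge; apply: contra nz_x => lew; apply/eqP.
pose d c := coord_elt c + coord_elt (e (coord_group c)).
apply: punctured_word_inj => c nEc; apply/eqP/negPn/negP => nz_c.
set T := [set c | (c \notin E) && (word x c != 0)] in lew.
have Tc : c \in T by rewrite inE nEc.
case/eqP: (nz_c); apply: (moore_independent (d := d) char2 lew _ _ Tc) => [S sST|a lta].
  apply: punctured_elts_independent => // [c' /(subsetP sST)|].
    by rewrite inE inE_e => /andP[].
  exact: leq_trans (subset_leq_card sST) lew.
(* Outside [T], either the word vanishes or the coordinate is punctured and [d] vanishes. *)
have -> : \sum_(c' in T) word x c' * d c' ^+ (2 ^ a)
        = \sum_c' word x c' * d c' ^+ (2 ^ a).
  rewrite [RHS](bigID (mem T)) /= [X in _ + X]big1 ?addr0 // => c'.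
  rewrite inE negb_and !negbK => /orP[|/eqP ->]; last by rewrite mul0r.
  rewrite inE_e => /eqP ec'; rewrite /d -ec' addrr_pchar2 //.
  by rewrite expr0n expn_eq0 mulr0.
under eq_bigr => c' _.
  rewrite /d exprDn_pchar; last by rewrite (eq_pnat _ (pcharf_eq char2)) pnatX pnat_id.
  rewrite mulrDr; over.
(* The first half is a heavy check. In the second the punctured element is constant on each group,
   where the word sums to zero. *)
rewrite big_split /= sum_word_elt // add0r.
rewrite (partition_big coord_group predT) //= big1 // => g _.
rewrite -[RHS](mul0r (coord_elt (e g) ^+ (2 ^ a))).
rewrite -[X in _ = X * _](sum_group_word x g) mulr_suml.
by apply: eq_bigr => c' /eqP ->.
Qed.

Lemma card_punctured : #|~: E| = (k + h)%N.
Proof.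
have -> : E = [set e g | g : 'I_l].
  apply/setP => c; rewrite inE_e; apply/eqP/imsetP => [->|[g _ ->]]; last by rewrite eg.
  by exists (coord_group c).
rewrite cardsCs setCK card_imset; last by move=> g g' /(congr1 coord_group); rewrite !eg.
by rewrite card_sum !card_ord addnK.
Qed.

(** Singleton bound by pigeonhole: two messages agree on [k - 1] of the [k + h] remaining
    coordinates. *)
Lemma punctured_word_singleton : (0 < k)%N ->
  exists x, x != 0 /\ (punct_weight heavy_mx grp E x <= h.+1)%N.
Proof.
move=> k_gt0; pose z := take k.-1 (enum (~: E)).
have sz : size z = k.-1.
  by rewrite size_takel // -cardE card_punctured (leq_trans (leq_pred _)) ?leq_addr.
pose f x := [ffun j : 'I_k.-1 => word x (tnth (tcast sz (in_tuple z)) j)].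
have /injectivePn[x1 [x2 ne12 eqf]] : ~~ injectiveb f.
  apply/negP => /injectiveP/leq_card.
  rewrite card_mx card_ffun card_ord mul1n leq_exp2l ?finNzRing_gt1 //.
  by case: (k) k_gt0 => // k' _; rewrite ltnn.
exists (x1 - x2); rewrite subr_eq0; split=> //.
have zero c : c \in z -> word (x1 - x2) c = 0.
  have -> : (c \in z) = (c \in tcast sz (in_tuple z)) by rewrite memtE val_tcast.
  move=> /tnthP[j ->]; rewrite wordB.
  by have /ffunP/(_ j) := eqf; rewrite !ffunE => ->; rewrite subrr.
have uz : uniq z by rewrite take_uniq ?enum_uniq.
have sub : [set c in z] \subset ~: E.
  by apply/subsetP => c; rewrite inE => /mem_take; rewrite mem_enum.
apply: (@leq_trans #|~: E :\: [set c in z]|).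
  apply/subset_leq_card/subsetP => c; rewrite !inE => /andP[-> nz]; rewrite andbT.
  by apply: contra nz => /zero ->.
have cz : #|[set c in z]| = k.-1 by rewrite cardsE; move/card_uniqP: uz => ->.
rewrite cardsDS // cz card_punctured.
by case: (k) k_gt0 => // k' _; rewrite addSn subSn ?leq_addr // addKn.
Qed.
End Puncture.

Lemma heavy_mx_maximally_recoverable : (0 < k)%N ->
  maximally_recoverable heavy_mx grp.
Proof.
move=> k_gt0 E cardE; have /fin_all_exists[e eP] g : exists c0, forall c,
    (c \in E) && (coord_group c == g) = (c == c0).
  have /eqP/cards1P[c0 Ec0] := cardE g; exists c0 => c.
  by have /setP/(_ c) := Ec0; rewrite !inE => <-; case: c.
split; first by move=> x; exact: punctured_word_inj eP _.
split; first by move=> x; exact: punctured_word_weight eP _.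
have [x [nz_x lex]] := punctured_word_singleton eP k_gt0; exists x; split=> //.
by apply/eqP; rewrite eqn_leq lex; exact: punctured_word_weight eP _ nz_x.
Qed.
End Code.

(** * Extensions of finite fields *)

Lemma finField_card_pchar (K : finFieldType) : exists p k,
  [/\ prime p, p \in [pchar K] & #|K| = (p ^ k)%N].
Proof.
have [p pr_p pcharK] := finPcharP K.
by exists p, (logn p #|K|); split=> //; exact: card_pprimeChar pcharK.
Qed.

Lemma exprD_card (K : finFieldType) (L : fieldExtType K) n (x y : L) :
  (x + y) ^+ (#|K| ^ n) = x ^+ (#|K| ^ n) + y ^+ (#|K| ^ n).
Proof.
have [p [k [pr_p pcharK ->]]] := finField_card_pchar K.
have pcharL : p \in [pchar L] by rewrite pchar_lalg.
by rewrite exprDn_pchar // -expnM (eq_pnat _ (pcharf_eq pcharL)) pnatX pnat_id.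
Qed.

Lemma exprN_card (K : finFieldType) (L : fieldExtType K) n (x : L) :
  (- x) ^+ (#|K| ^ n) = - x ^+ (#|K| ^ n).
Proof.
apply/eqP; rewrite -addr_eq0 -exprD_card addNr expr0n expn_eq0 -leqn0 leqNgt.
by rewrite (ltn_trans _ (finNzRing_gt1 K)).
Qed.

Lemma alg_expr_card (K : finFieldType) (L : fieldExtType K) n (c : K) :
  (c%:A : L) ^+ (#|K| ^ n) = c%:A.
Proof.
elim: n => [|n IHn]; first by rewrite expr1.
by rewrite expnSr exprM IHn -in_algE -rmorphXn expf_card.
Qed.

Lemma expr_card_dim (K : finFieldType) (L : fieldExtType K) (x : L) :
  x ^+ (#|K| ^ \dim {:L}) = x.
Proof. by apply/eqP; rewrite -Fermat's_little_theorem memvf. Qed.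

Lemma expr_card_algP (K : finFieldType) (L : fieldExtType K) (x : L) :
  x ^+ #|K| = x -> exists c : K, x = c%:A.
Proof.
move=> /eqP xq; apply/vlineP; rewrite (Fermat's_little_theorem 1%AS).
by rewrite dimv1 expn1.
Qed.

(** Take the splitting field of [X^m - X]. The roots are the fixed field of the [n]-th power of
    Frobenius, hence all of [L]; they are distinct, so [L] has [m] elements. *)
Lemma finField_extension (K : finFieldType) n : (0 < n)%N ->
  {L : fieldExtType K | \dim {:L} = n}.
Proof.
move=> n_gt0; pose m := (#|K| ^ n)%N.
have m_gt1 : (1 < m)%N by rewrite -(expn0 #|K|) ltn_exp2l ?finNzRing_gt1.
have m_gt0 := ltnW m_gt1; have m1_gt0 : (0 < m.-1)%N by rewrite -ltnS prednK.
pose q (R : nzRingType) : {poly R} := 'X^m - 'X.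
have Dq R : q R = ('X^(m.-1) - 1) * ('X - 0).
  by rewrite /q subr0 mulrBl mul1r -exprSr prednK.
have /FinSplittingFieldFor[/= L splitLq] : q K != 0.
  by rewrite Dq monic_neq0 ?rpredM ?monicXsubC ?monicXnsubC.
rewrite [map_poly _ _]rmorphB rmorphXn /= map_polyX -/(q L) in splitLq.
exists L; have [zs DqL defL] := splitLq.
have in_zs z : (z \in zs) = (z ^+ m == z).
  by rewrite -root_prod_XsubC -(eqp_root DqL) /root !hornerE subr_eq0.
(* Hence [m - 1] is nonzero in [L] and [X^(m-1) - 1] is separable. *)
have m0 : m%:R = 0 :> L.
  have [p [k [pr_p pcharK cardK]]] := finField_card_pchar K.
  have pcharL : p \in [pchar L] by rewrite pchar_lalg.
  apply/eqP; rewrite -(dvdn_pcharf pcharL) /m cardK -expnM dvdn_exp //.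
  rewrite muln_gt0 n_gt0 andbT lt0n; apply/eqP => k0.
  by have := finNzRing_gt1 K; rewrite cardK k0.
have Uzs : uniq zs.
  rewrite -separable_prod_XsubC -(eqp_separable DqL) Dq separable_root andbC.
  rewrite /root !hornerE subr_eq0 eq_sym expr0n gtn_eqF ?oner_eq0 //=.
  rewrite cyclotomic.separable_Xn_sub_1 // -subn1 natrB // subr_eq0 m0.
  by rewrite eq_sym oner_eq0.
have /finField_galois_generator[/= a _ Da] : (1 <= {:L})%VS by apply: sub1v.
rewrite dimv1 expn1 in Da; pose Em := fixedSpace (a ^+ n)%g.
have zsE : zs =i Em.
  move=> z; rewrite in_zs (sameP fixedSpaceP eqP); congr (_ == z).
  rewrite /m; elim: (n) => [|i IHi]; first by rewrite gal_id.
  by rewrite expgSr expnSr exprM IHi galM ?Da ?memvf.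
have defEm : Em = {:L}%VS.
  apply/eqP; rewrite eqEsubv subvf -defL -[Em]subfield_closed agenvS //.
  by rewrite subv_add sub1v; apply/span_subvP=> z; rewrite zsE.
have szs : size zs = m.
  apply: succn_inj; rewrite -(size_prod_XsubC _ id) -(eqp_size DqL).
  by rewrite size_polyDl size_polyXn // size_polyN size_polyX.
have cardL : #|finvect_type L| = m.
  have /card_uniqP Uz : uniq (zs : seq (finvect_type L)) by exact: Uzs.
  rewrite -szs -Uz; apply: eq_card => x.
  have zs_x : ((x : L) \in zs) = true by rewrite zsE defEm memvf.
  exact: esym zs_x.
apply/eqP; rewrite -(eqn_exp2l _ _ (finNzRing_gt1 K)) -/m -cardL.
have <- := card_vspace ({: finvect_type L}%VS : {vspace finvect_type L}).
by apply/eqP/eq_card => x; rewrite memvf.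
Qed.

(** * Points in general position *)

(* The hypothesis says that z ^+ #|K| is the image of z under the homography of
   matrix [[-c, -b], [a, c]], which is an involution, having trace 0. *)
Lemma mobius_conjugate_scalar (K : finFieldType) (L : fieldExtType K)
    (a b c z : L) :
  odd (\dim {:L}) -> a ^+ #|K| = a -> b ^+ #|K| = b -> c ^+ #|K| = c -> c != 0 ->
  a * (z * z ^+ #|K|) + c * (z + z ^+ #|K|) + b = 0 -> exists d : K, z = d%:A.
Proof.
set q := #|K| => oddL aq bq cq nz_c E1.
have D (x y : L) : (x + y) ^+ q = x ^+ q + y ^+ q by have := exprD_card 1 x y.
have B (x y : L) : (x - y) ^+ q = x ^+ q - y ^+ q.
  by rewrite D; have := exprN_card 1 y => ->.
apply: expr_card_algP; rewrite -/q.
have q_gt0 : (0 < q)%N by exact: ltnW (finNzRing_gt1 K).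
have E2 : a * (z ^+ q * z ^+ q ^+ q) + c * (z ^+ q + z ^+ q ^+ q) + b = 0.
  have := congr1 (fun x => x ^+ q) E1; rewrite /= expr0n gtn_eqF //.
  by rewrite !D !exprMn !D aq bq cq.
have /eqP : (z - z ^+ q ^+ q) * (a * z ^+ q + c) = 0.
  move: (z ^+ q) (z ^+ q ^+ q) E1 E2 => w w' E1 E2.
  rewrite -[RHS](subr0 0) -{1}E1 -{1}E2; ring.
rewrite mulf_eq0 subr_eq0 => /orP[/eqP zqq|/eqP aw].
  (* [z] is fixed by the even powers of Frobenius and by an odd one, the degree of [L], hence by
     Frobenius. *)
  have zq2 j : z ^+ (q ^ j.*2) = z.
    elim: j => [|j IHj]; first by rewrite expr1.
    by rewrite doubleS !expnSr !exprM IHj -zqq.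
  have := expr_card_dim z; rewrite -{1}(odd_double_half (\dim {:L})) oddL add1n.
  by rewrite expnSr exprM zq2.
(* In the other case [z ^+ q = - c / a] is fixed by Frobenius, which is injective. *)
have nz_a : a != 0.
  by apply: contraNneq nz_c => a0; rewrite -aw a0 mul0r add0r.
have wq : z ^+ q ^+ q = z ^+ q.
  have w : z ^+ q = - c / a.
    by apply: (mulfI nz_a); rewrite [RHS]mulrC divfK //; apply/eqP; rewrite -addr_eq0 aw.
  by rewrite {1}w exprMn exprVn -[- c]sub0r B expr0n gtn_eqF // aq cq sub0r -w.
apply/eqP; rewrite -subr_eq0; have /eqP := B (z ^+ q) z.
by rewrite wq subrr expf_eq0 q_gt0.
Qed.

Local Notation alg L := (in_alg L : {rmorphism _ -> _}).

(** Turns scalings into products, within reach of [ring]. *)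
Lemma scale_in_alg (K : fieldType) (L : fieldExtType K) (c : K) (x : L) :
  c *: x = alg L c * x.
Proof. by rewrite /= mulr_algl. Qed.

Section Points.
Variables (K : finFieldType) (V L : fieldExtType K) (phi : {linear V -> L}).
Variable s : nat.
Hypothesis phi_inj : injective phi.
Hypothesis oddL : odd (\dim {:L}).
Local Notation q := #|K|.

Definition hermite (x : V) : L := phi x * phi x ^+ q.

(* The norm of V over its subfield of order q ^ s, when \dim V = 3 * s. *)
Definition cubic_norm (x : V) : V := x * x ^+ (q ^ s) * x ^+ (q ^ (s * 2)).

Let phi0 y : y != 0 -> phi y != 0.
Proof. by apply: contraNneq => y0; apply/eqP/phi_inj; rewrite y0 linear0. Qed.

Lemma hermite_polar (x y : V) : hermite (x + y) =
  hermite x + hermite y + (phi x * phi y ^+ q + phi y * phi x ^+ q).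
Proof.
have D (u v : L) : (u + v) ^+ q = u ^+ q + v ^+ q by have := exprD_card 1 u v.
by rewrite /hermite linearD D; ring.
Qed.

Lemma hermiteZ (a : K) (x : V) : hermite (a *: x) = a ^+ 2 *: hermite x.
Proof.
rewrite /hermite linearZ /= !scale_in_alg exprMn.
have -> : alg L a ^+ q = alg L a by have := alg_expr_card L 1 a.
by rewrite rmorphXn; ring.
Qed.

Lemma cubic_norm_eq0 x : (cubic_norm x == 0) = (x == 0).
Proof.
have q_gt0 : (0 < q)%N by exact: ltnW (finNzRing_gt1 K).
by rewrite /cubic_norm !mulf_eq0 !expf_eq0 !expn_gt0 q_gt0 /= !orbb.
Qed.

(** Powers of Frobenius are K-linear, so the norm is a product of three factors affine in [t]. *)
Lemma cubic_norm_line (x y : V) : exists A B : V, forall t : K,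
  cubic_norm (x + t *: y) =
  cubic_norm x + t *: A + t ^+ 2 *: B + t ^+ 3 *: cubic_norm y.
Proof.
set u := x ^+ (q ^ s); set u' := x ^+ (q ^ (s * 2)).
set v := y ^+ (q ^ s); set v' := y ^+ (q ^ (s * 2)).
exists (y * u * u' + x * v * u' + x * u * v'), (x * v * v' + y * u * v' + y * v * u').
move=> t; have powE n :
    (x + t *: y) ^+ (q ^ n) = x ^+ (q ^ n) + alg V t * y ^+ (q ^ n).
  by rewrite exprD_card scale_in_alg exprMn /= alg_expr_card.
rewrite /cubic_norm !powE -/u -/u' -/v -/v' !scale_in_alg !rmorphXn.
move: (alg V t) u u' v v' => T u u' v v'; ring.
Qed.

(** A K-linear relation between the points [(1, x, hermite x, cubic_norm x)]. *)
Definition balanced (xs : seq V) (c : V -> K) : Prop :=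
  [/\ \sum_(x <- xs) c x = 0, \sum_(x <- xs) c x *: x = 0,
      \sum_(x <- xs) c x *: hermite x = 0
    & \sum_(x <- xs) c x *: cubic_norm x = 0].

(** [y1] and [y2] are differences with a third point. If [y1 = t *: y2], the relations give
    [t ^+ 2 = t], while [t] is neither 0 nor 1. *)
Lemma three_points_independent (y1 y2 : V) (c1 c2 : K) :
  y1 != 0 -> y2 != 0 -> y1 != y2 -> c1 != 0 ->
  c1 *: y1 + c2 *: y2 = 0 ->
  c1 *: hermite y1 + c2 *: hermite y2 = 0 -> False.
Proof.
move=> nz1 nz2 ne nzc lin quad.
pose t := - c2 / c1.
have y1E : y1 = t *: y2.
  apply: (scalerI nzc); rewrite scalerA [c1 * t]mulrC divfK // scaleNr.
  by apply/eqP; rewrite -addr_eq0 lin.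
have nz_h : hermite y2 != 0 by rewrite mulf_neq0 ?expf_neq0 ?phi0.
move: quad; rewrite y1E hermiteZ scalerA -scalerDl => /eqP.
rewrite scaler_eq0 (negPf nz_h) orbF => /eqP e.
have : c2 * (c2 + c1) = 0.
  by rewrite -[RHS](mulr0 c1) -e /t; field.
move/eqP; rewrite mulf_eq0 => /orP[/eqP c20|].
  by move: nz1; rewrite y1E /t c20 oppr0 mul0r scale0r eqxx.
rewrite addr_eq0 => /eqP c2E; case/eqP: ne.
by rewrite y1E /t c2E opprK divff // scale1r.
Qed.

(** The points are [x], [x + y1], [x + y2], [x + y3]. The first two relations put them on a K-line,
    where the weighted moments of orders 1, 2, 3 of their parameters vanish. *)
Lemma four_points_independent (y1 y2 y3 x : V) (c1 c2 c3 : K) :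
  y1 != 0 -> y2 != 0 -> y1 != y2 -> y1 != y3 ->
  c1 != 0 -> c2 != 0 -> c3 != 0 ->
  c1 *: y1 + c2 *: y2 + c3 *: y3 = 0 ->
  c1 *: hermite y1 + c2 *: hermite y2 + c3 *: hermite y3 = 0 ->
  c1 *: (cubic_norm (x + y1) - cubic_norm x) +
  c2 *: (cubic_norm (x + y2) - cubic_norm x) +
  c3 *: (cubic_norm (x + y3) - cubic_norm x) = 0 -> False.
Proof.
move=> nz1 nz2 ne12 ne13 nzc1 nzc2 nzc3 lin quad cub.
pose al := - c1 / c3; pose be := - c2 / c3.
have y3E : y3 = al *: y1 + be *: y2.
  apply: (scalerI nzc3); rewrite scalerDr !scalerA ![c3 * _]mulrC !divfK //.
  by rewrite !scaleNr -opprD; apply/eqP; rewrite -addr_eq0 addrC lin.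
have h3 : hermite y3 = al *: hermite y1 + be *: hermite y2.
  apply: (scalerI nzc3); rewrite scalerDr !scalerA ![c3 * _]mulrC !divfK //.
  by rewrite !scaleNr -opprD; apply/eqP; rewrite -addr_eq0 addrC quad.
have nz_al : al != 0 by rewrite mulf_neq0 ?oppr_eq0 ?invr_eq0.
have nz_be : be != 0 by rewrite mulf_neq0 ?oppr_eq0 ?invr_eq0.
move: al be nz_al nz_be y3E h3 => al be nz_al nz_be y3E h3.
(* The points lie on a line: d is the ratio of the differences y1 and y2. *)
have [d y1E] : exists d : K, y1 = d *: y2.
  have := hermite_polar (al *: y1) (be *: y2).
  rewrite -y3E h3 !hermiteZ !linearZ /= /hermite.
  have : phi y2 != 0 by exact: phi0.
  move Du : (phi y1) => u; move Dv : (phi y2) => v nz_v.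
  pose z := u / v.
  have qK (c : K) : alg L c ^+ q = alg L c by exact: (alg_expr_card L 1 c).
  rewrite !scale_in_alg !exprMn !qK => E.
  have nz_vq : v ^+ q != 0 by rewrite expf_neq0.
  (* The polar expansion of [hermite y3] minus its value [h3], divided by [v ^+ (q + 1)]. *)
  have [||d zE] := @mobius_conjugate_scalar K L (alg L (al ^+ 2 - al))
    (alg L (be ^+ 2 - be)) (alg L (al * be)) z oddL (qK _) (qK _) (qK _).
  - by rewrite fmorph_eq0 mulf_neq0.
  - apply: (mulIf (mulf_neq0 nz_v nz_vq)); rewrite mul0r.
    have -> : z ^+ q = u ^+ q / v ^+ q by rewrite exprMn exprVn.
    move: E; rewrite /z !(rmorphB, rmorphM, rmorphXn).
    move: (alg L al) (alg L be) (u ^+ q) (v ^+ q) nz_vq => A B uq vq nz_vq E.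
    transitivity ((A ^+ 2 * (u * uq) + B ^+ 2 * (v * vq)
      + (A * u * (B * vq) + B * v * (A * uq))) - (A * (u * uq) + B * (v * vq))).
      field; by rewrite ?nz_v ?nz_vq.
    by rewrite E subrr.
  exists d; apply: phi_inj; rewrite linearZ /= -[RHS]mulr_algl -zE /z Du Dv divfK //.
set t1 := d in y1E; pose t3 := al * d + be.
have {}y3E : y3 = t3 *: y2 by rewrite y3E y1E scalerA -scalerDl.
have nz_h : hermite y2 != 0 by rewrite mulf_neq0 ?expf_neq0 ?phi0.
have s1 : c1 * t1 + c2 + c3 * t3 = 0.
  apply/eqP; move/eqP: lin; rewrite y1E y3E !scalerA -!scalerDl scaler_eq0.
  by rewrite (negPf nz2) orbF.
have s2 : c1 * t1 ^+ 2 + c2 + c3 * t3 ^+ 2 = 0.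
  apply/eqP; move/eqP: quad; rewrite y1E y3E !hermiteZ !scalerA -!scalerDl scaler_eq0.
  by rewrite (negPf nz_h) orbF.
(* [s1] and [s2] cancel the terms in [A] and [B]; the leading coefficient [cubic_norm y2] is
   nonzero. *)
have s3 : c1 * t1 ^+ 3 + c2 + c3 * t3 ^+ 3 = 0.
  have [A [B NE]] := cubic_norm_line x y2.
  have NE1 t : cubic_norm (x + t *: y2) - cubic_norm x =
      t *: A + t ^+ 2 *: B + t ^+ 3 *: cubic_norm y2 by rewrite NE; ring.
  apply/eqP; move/eqP: cub; rewrite y1E y3E !NE1.
  have -> : cubic_norm (x + y2) - cubic_norm x = A + B + cubic_norm y2.
    by have := NE1 1; rewrite !expr1n !scale1r.
  rewrite (_ : _ + _ = (c1 * t1 + c2 + c3 * t3) *: A +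
    (c1 * t1 ^+ 2 + c2 + c3 * t3 ^+ 2) *: B +
    (c1 * t1 ^+ 3 + c2 + c3 * t3 ^+ 3) *: cubic_norm y2).
    rewrite s1 s2 !scale0r !add0r scaler_eq0 cubic_norm_eq0.
    by rewrite (negPf nz2) orbF.
  rewrite !scale_in_alg !(rmorphD, rmorphM, rmorphXn).
  move: (alg V c1) (alg V c2) (alg V c3) (alg V t1) (alg V t3) => C1 C2 C3 T1 T3.
  ring.
(* Vandermonde: only the first term survives in the combination of s1, s2, s3
   given by the polynomial T (T - 1) (T - t3). *)
have : c1 * t1 * (t1 - 1) * (t1 - t3) = 0.
  transitivity ((c1 * t1 ^+ 3 + c2 + c3 * t3 ^+ 3)
    - (1 + t3) * (c1 * t1 ^+ 2 + c2 + c3 * t3 ^+ 2)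
    + t3 * (c1 * t1 + c2 + c3 * t3)); first ring.
  by rewrite s1 s2 s3 !mulr0 subrr addr0.
move/eqP; rewrite !mulf_eq0 (negPf nzc1) !subr_eq0 /= => /orP[/orP[]|] /eqP t1E.
- by rewrite y1E t1E scale0r eqxx in nz1.
- by rewrite y1E t1E scale1r eqxx in ne12.
by rewrite y1E y3E t1E eqxx in ne13.
Qed.

(** As the coefficients sum to zero, the first point can be moved to the origin, leaving at most
    three differences. *)
Lemma balanced_support_nil (xs : seq V) (c : V -> K) :
  uniq xs -> (size xs <= 4)%N -> {in xs, forall x, c x != 0} ->
  balanced xs c -> xs = [::].
Proof.
move=> uxs sxs nzc [].
case: xs uxs sxs nzc => [//|x xs] /= /andP[x_xs uxs]; rewrite ltnS => sxs nzc.
have nzD y : y \in xs -> y - x != 0.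
  by move=> xs_y; rewrite subr_eq0; apply: contraNneq x_xs => <-.
rewrite !big_cons => sc sx sh sN.
have cx : c x = - \sum_(y <- xs) c y by apply/eqP; rewrite -addr_eq0 sc.
have shift (W : lmodType K) (g : V -> W) : c x *: g x + \sum_(y <- xs) c y *: g y = 0 ->
    \sum_(y <- xs) c y *: (g y - g x) = 0.
  move=> gx; rewrite -[RHS]gx cx scaleNr scaler_suml -sumrN -big_split /=.
  by apply: eq_bigr => y _; rewrite scalerBr addrC.
have lin : \sum_(y <- xs) c y *: (y - x) = 0 by exact: (shift V id).
have quad : \sum_(y <- xs) c y *: hermite (y - x) = 0.
  (* The polar terms are linear in [phi (y - x)] and its conjugate, whose weighted sums both
     vanish. *)
  have phi_sum : \sum_(y <- xs) c y *: phi (y - x) = 0.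
    by under eq_bigr => y _ do rewrite -linearZ; rewrite -linear_sum lin linear0.
  have frob (u v : L) : (u + v) ^+ q = u ^+ q + v ^+ q by have := exprD_card 1 u v.
  have phiq_sum : \sum_(y <- xs) c y *: phi (y - x) ^+ q = 0.
    have q0 : (0 : L) ^+ q = 0 by rewrite expr0n gtn_eqF // (ltnW (finNzRing_gt1 K)).
    have := congr1 (fun u => u ^+ q) phi_sum; rewrite /= q0 (big_morph _ frob q0).
    apply: etrans; apply: eq_bigr => y _.
    rewrite !scale_in_alg exprMn; congr (_ * _).
    by have := esym (alg_expr_card L 1 (c y)).
  have hE y : hermite (y - x) = (hermite y - hermite x)
      - (phi x * phi (y - x) ^+ q + phi x ^+ q * phi (y - x)).
    by have := hermite_polar x (y - x); rewrite [x + _]addrC subrK => ->; ring.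
  under eq_bigr => y _ do rewrite hE scalerBr (scalerDr _ (phi x * _)) !scalerAr.
  by rewrite sumrB big_split /= -!mulr_sumr (shift _ _ sh) phi_sum phiq_sum; ring.
have cub : \sum_(y <- xs) c y *: (cubic_norm (x + (y - x)) - cubic_norm x) = 0.
  by under eq_bigr => y _ do rewrite [x + _]addrC subrK; exact: shift.
have nzcx : c x != 0 by apply: nzc; rewrite mem_head.
have {}nzc : {in xs, forall y, c y != 0}.
  by move=> y xs_y; apply: nzc; rewrite inE xs_y orbT.
have ne y y' : y != y' -> y - x != y' - x by rewrite (inj_eq (addIr _)).
move: xs uxs sxs nzc nzD lin quad cub cx {x_xs sc sx sh sN shift}.
case=> [|y1 [|y2 [|y3 [|//]]]] /= uxs _ nzc nzD; rewrite !(big_cons, big_nil) ?addr0.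
- by move=> _ _ _ cx0; rewrite cx0 oppr0 eqxx in nzcx.
- move=> /eqP; rewrite scaler_eq0 (negPf (nzc _ _)) ?(negPf (nzD _ _)) //;
  by rewrite inE.
- move: uxs; rewrite inE andbT => ne12 lin quad _ _.
  by case: (three_points_independent _ _ (ne _ _ ne12) _ lin quad);
    rewrite ?nzD ?nzc // !inE eqxx ?orbT.
move: uxs; rewrite !inE negb_or andbT => /andP[/andP[ne12 ne13] _].
rewrite !(addrA (c y1 *: _)) => lin quad cub _.
by case: (four_points_independent _ _ (ne _ _ ne12) (ne _ _ ne13) _ _ _ lin quad cub);
  rewrite ?nzD ?nzc // !inE eqxx ?orbT.
Qed.

End Points.

(** * Embedding into the ground field *)

Lemma linear_embedding (K : fieldType) (U W : vectType K) :
  (dim U <= dim W)%N -> exists f : {linear U -> W}, injective f.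
Proof.
move=> leUW; exists (r2v \o mulmxr (pid_mx (dim U)) \o v2r) => u u' /= /r2v_inj eqf.
apply: v2r_inj; rewrite -[v2r u]mulmx1 -[v2r u']mulmx1 -pid_mx_1.
by rewrite -(pid_mx_id _ _ _ leUW) !mulmxA eqf.
Qed.

(** An element of [W] is coded by the F_p-coordinates of its K-coordinates, [dim W * r] in all. *)
Lemma additive_embedding (K F : finFieldType) (p r t : nat) (W : vectType K) :
  prime p -> #|K| = (p ^ r)%N -> #|F| = (p ^ t)%N -> (dim W * r <= t)%N ->
  exists f : {additive W -> F}, injective f.
Proof.
move=> pr_p cardK cardF led.
have pcharK := card_finPcharP cardK pr_p; have pcharF := card_finPcharP cardF pr_p.
have dimK : dim (pPrimeCharType pcharK) = r.
  by rewrite -dimvf pprimeChar_dimf cardK pfactorK.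
have dimF : dim (pPrimeCharType pcharF) = t.
  by rewrite -dimvf pprimeChar_dimf cardF pfactorK.
have [g inj_g] : exists g : {linear pPrimeCharType pcharK -> 'rV['F_p]_r}, injective g.
  by apply: linear_embedding; rewrite dimK /dim /= mul1n.
have [h inj_h] :
    exists h : {linear 'M['F_p]_(dim W, r) -> pPrimeCharType pcharF}, injective h.
  by apply: linear_embedding; rewrite dimF.
pose f (w : W) : F := h (\matrix_(i, j) g (v2r w 0 i) 0 j).
have f_add : zmod_morphism f.
  move=> w w'; rewrite /f -raddfB; congr (h _).
  by apply/matrixP => i j; rewrite linearB !mxE raddfB !mxE.
exists (HB.pack_for {additive W -> F} f (GRing.isZmodMorphism.Build W F f f_add)).
move=> w w' /inj_h/matrixP eqm; apply: v2r_inj; apply/rowP => i; apply: inj_g.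
by apply/rowP => j; have := eqm i j; rewrite !mxE.
Qed.

(** Meant to contain the norms. The dimension is bounded by counting the roots of [X^(q^s) - X]. *)
Lemma fixed_subspace (K : finFieldType) (V : fieldExtType K) (s : nat) :
  (0 < s)%N -> exists U : {vspace V},
    (dim (subvs_of U) <= s)%N /\ forall x, x ^+ (#|K| ^ s) = x -> x \in U.
Proof.
move=> s_gt0; set q := #|K|; pose f (x : V) := x ^+ (q ^ s) - x.
have f_lin : linear f.
  move=> a x y; rewrite /f exprD_card -(mulr_algl a x) exprMn alg_expr_card.
  by rewrite !mulr_algl scalerBr opprD addrACA.
pose fL : {linear V -> V} := HB.pack_for {linear V -> V} f
  (GRing.isLinear.Build K V V _ f f_lin).
pose U := lker (linfun fL); exists U.
have memU x : (x \in U) = (x ^+ (q ^ s) == x).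
  by rewrite memv_ker lfunE /= subr_eq0.
split=> [|x xq]; last by rewrite memU xq.
have q_gt1 : (1 < q)%N := finNzRing_gt1 K.
rewrite -(leq_exp2l _ _ q_gt1).
have qs_gt1 : (1 < q ^ s)%N by rewrite -(expn0 q) ltn_exp2l.
have <- := card_vspace (U : {vspace finvect_type V}).
pose p : {poly V} := 'X^(q ^ s) - 'X.
have sz_p : size p = (q ^ s).+1.
  by rewrite size_polyDl size_polyXn // size_polyN size_polyX.
pose rs : seq V := enum (U : {vspace finvect_type V}).
rewrite cardE -ltnS -sz_p; apply: (@max_poly_roots _ p rs).
- by rewrite -size_poly_eq0 sz_p.
- apply/(@allP V) => x; have := @mem_enum (finvect_type V) (mem U) x; rewrite memU.
  by rewrite /root !hornerE subr_eq0 => /esym ->.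
exact: (@enum_uniq (finvect_type V)).
Qed.

(** [theta] identifies F_2^r with K and [P g] embeds the K-line of the [g]-th point, so a vanishing
    sum is a K-relation between at most four points. *)
Lemma independent_group_maps (F : finFieldType) (l r s : nat) :
  (0 < r)%N -> (l <= 2 ^ (r * (3 * s)))%N -> #|F| = (2 ^ (r * (7 * s + 2)))%N ->
  exists P : 'I_l -> {additive 'rV['F_2]_r -> F},
  forall (G : {set 'I_l}) (u : 'I_l -> 'rV['F_2]_r),
    (#|G| <= 4)%N -> \sum_(g in G) P g (u g) = 0 -> {in G, forall g, u g = 0}.
Proof.
move=> r_gt0 le_l cardF.
have [K charK cardK] := @pPrimePowerField 2 r isT r_gt0.
have [theta theta_inj] : exists f : {additive 'rV['F_2]_r -> K}, injective f.
  apply: (@additive_embedding _ _ 2 1 r) => //; first by rewrite card_Fp.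
  by rewrite /dim /= mul1n muln1.
have thetaE v : (theta v == 0) = (v == 0).
  by rewrite -(raddf0 theta) (inj_eq theta_inj).
(* For [s = 0] there is at most one group, and any embedding works. *)
have [s0|s_gt0] := posnP s.
  have [f f_inj] : exists f : {additive 'rV['F_2]_r -> F}, injective f.
    apply: (@additive_embedding _ _ 2 1 (r * (7 * s + 2))) => //.
      by rewrite card_Fp.
    by rewrite /dim /= s0 mul1n; lia.
  exists (fun _ => f) => G u _ sum0 g Gg; apply: f_inj; rewrite raddf0 -[RHS]sum0.
  rewrite (bigD1 g) //= big1 ?addr0 // => g' /andP[_ /eqP[]].
  apply: val_inj; have := ltn_ord g; have := ltn_ord g'.
  by move: le_l; rewrite s0 !muln0 expn0 /=; lia.
pose M := if odd s then (3 * s)%N else (3 * s).+1.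
have [V dimV] : {V : fieldExtType K | \dim {:V} = (3 * s)%N}.
  by apply: finField_extension; rewrite muln_gt0.
have [L dimL] : {L : fieldExtType K | \dim {:L} = M}.
  by apply: finField_extension; rewrite /M; case: ifP; rewrite // muln_gt0.
have oddL : odd (\dim {:L}).
  by rewrite dimL /M; case: ifP => /= [|/negbT]; rewrite oddM.
have leM : (3 * s <= M <= (3 * s).+1)%N.
  by rewrite /M; case: ifP => _; rewrite leqnn leqnSn.
have [phi phi_inj] : exists f : {linear V -> L}, injective f.
  by apply: linear_embedding; rewrite -!dimvf dimV dimL; case/andP: leM.
have [U [dimU fixU]] := fixed_subspace V s_gt0.
(* Its dimension is at most [1 + 3s + (3s + 1) + s = 7s + 2]. *)
pose W : vectType K := (K^o * (V * (L * subvs_of U)))%type.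
have [f f_inj] : exists f : {additive W -> F}, injective f.
  apply: (@additive_embedding _ _ 2 r (r * (7 * s + 2))) => //.
  have -> : dim W = (1 + (dim V + (dim L + dim (subvs_of U))))%N by [].
  rewrite -(dimvf V) dimV -(dimvf L) dimL mulnC leq_mul2l; apply/orP; right.
  by case/andP: leM => _; move: dimU; move: (dim _) => d; lia.
have [x x_inj] : exists x : 'I_l -> V, injective x.
  have cardV : #|finvect_type V| = (2 ^ (r * (3 * s)))%N.
    rewrite expnM -cardK -dimV.
    rewrite -(card_vspace ({: finvect_type V}%VS : {vspace finvect_type V})).
    by apply/esym/eq_card => y; rewrite memvf.
  rewrite -cardV in le_l; exists (fun g => enum_val (widen_ord le_l g)) => g g'.
  by move=> eqg; have /(congr1 val) /= := @enum_val_inj (finvect_type V) _ _ _ eqg;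
  exact: val_inj.
(* Frobenius to the power [s] permutes the three factors cyclically, as [y ^+ (q ^ (3s)) = y]. *)
have normU y : cubic_norm s y \in U.
  apply: fixU; rewrite /cubic_norm !exprMn -!exprM -!expnD.
  have -> : (s * 2 + s = \dim {:V})%N by rewrite dimV; lia.
  by rewrite expr_card_dim addnn -muln2; ring.
pose pt y : W := (1, (y, (hermite phi y, vsproj U (cubic_norm s y)))).
pose Pf g (v : 'rV['F_2]_r) : F := f (theta v *: pt (x g)).
have P_add g : zmod_morphism (Pf g).
  by move=> v w; rewrite /Pf raddfB scalerBl raddfB.
pose P g : {additive 'rV['F_2]_r -> F} := HB.pack_for {additive 'rV['F_2]_r -> F}
  (Pf g) (GRing.isZmodMorphism.Build 'rV['F_2]_r F (Pf g) (P_add g)).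
exists P; rewrite /P /=.
move=> G u leG /=; rewrite -raddf_sum -[RHS](raddf0 f) => /f_inj sum0.
pose G' := [set g in G | u g != 0].
(* The coefficients are carried from groups to points; [x] being injective, each sum has at most one
   term. *)
pose c y := \sum_(g | x g == y) theta (u g).
have cE g : c (x g) = theta (u g).
  by rewrite /c (big_pred1 g) // => g'; rewrite (inj_eq x_inj).
pose xs := [seq x g | g <- enum G'].
have sum_xs (T : lmodType K) (h : V -> T) :
    \sum_(y <- xs) c y *: h y = \sum_(g in G) theta (u g) *: h (x g).
  rewrite big_map big_enum /= [RHS](bigID (fun g => u g != 0)) /=.
  rewrite [X in _ = _ + X]big1 ?addr0 => [|g /andP[_ /negPn/eqP ->]]; last first.
    by rewrite raddf0 scale0r.
  by apply: eq_big => [g|g _]; rewrite ?inE ?cE.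
have xs_nil : xs = [::].
  apply: (@balanced_support_nil K V L phi s phi_inj oddL xs c).
  - by rewrite map_inj_uniq ?enum_uniq.
  - rewrite size_map -cardE (leq_trans _ leG) //; apply: subset_leq_card.
    by apply/subsetP => g; rewrite inE => /andP[].
  - by move=> y /mapP[g]; rewrite mem_enum inE => /andP[_ ug] ->; rewrite cE thetaE.
  split.
  - have := congr1 fst sum0; rewrite raddf_sum /= => e.
    rewrite -[RHS]e -(sum_xs K^o (fun => 1)); apply: eq_bigr => y _.
    by rewrite -[LHS]mulr1.
  - by rewrite (sum_xs V id); have := congr1 (fst \o snd) sum0; rewrite /= !raddf_sum.
  - rewrite (sum_xs L (hermite phi)).
    by have := congr1 (fst \o snd \o snd) sum0; rewrite /= !raddf_sum.
  rewrite (sum_xs V (cubic_norm s)).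
  have := congr1 (vsval \o snd \o snd \o snd) sum0; rewrite /= !raddf_sum /= => e.
  by rewrite -[RHS]e; apply: eq_bigr => g _; rewrite vsprojK.
move=> g Gg; apply/eqP; have : g \notin G'.
  by rewrite -mem_enum; apply: contraT => /negbNE/(map_f x); rewrite -/xs xs_nil.
by rewrite inE Gg negbK.
Qed.

Lemma balanced_grouping (n l r : nat) : (0 < r)%N -> n = (l * r)%N ->
  exists (grp : 'I_n -> 'I_l) (idx : 'I_n -> 'I_r),
    (forall i j, grp i = grp j -> idx i = idx j -> i = j) /\
    (forall g, #|[set i | grp i == g]| = r).
Proof.
move=> r_gt0 nE.
have lt_grp (i : 'I_n) : (i %/ r < l)%N by rewrite ltn_divLR // -nE.
exists (fun i => Ordinal (lt_grp i)), (fun i : 'I_n => Ordinal (ltn_pmod i r_gt0)).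
split=> [i j [eqd] [eqm]|g].
  by apply: val_inj; rewrite /= (divn_eq i r) (divn_eq j r) eqd eqm.
have lt_mem (j : 'I_r) : (g * r + j < n)%N.
  rewrite nE (@leq_trans (g.+1 * r)) // ?leq_mul2r ?ltn_ord ?orbT //.
  by rewrite mulSn addnC ltn_add2r.
pose f j := Ordinal (lt_mem j).
have f_inj : injective f by move=> j j' [/addnI/val_inj].
rewrite -[RHS](card_ord r) -(card_imset _ f_inj); apply: eq_card => i; rewrite inE.
apply/eqP/imsetP => [/(congr1 val) /= ig|[j _ ->]].
  by exists (Ordinal (ltn_pmod i r_gt0)) => //; apply: val_inj; rewrite /= -ig -divn_eq.
by apply: val_inj; rewrite /= divnMDl // divn_small ?addn0.
Qed.

Theorem theorem18 (k r l m : nat) :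
  (0 < k)%N -> (0 < r)%N -> (k + 4 = l * r)%N ->
  (* m is the smallest integer with 3 | (m-1) and l <= 2^(r(m-1)) *)
  (1 <= m)%N -> (3 %| m - 1)%N -> (l <= 2 ^ (r * (m - 1)))%N ->
  (forall m' : nat, (1 <= m')%N -> (3 %| m' - 1)%N ->
      (l <= 2 ^ (r * (m' - 1)))%N -> (m <= m')%N) ->
  forall F : finFieldType, #|F| = (2 ^ (r * (2 * m + (m - 1) %/ 3)))%N ->
  exists (H : 'M[F]_(k, 4)) (grp : 'I_(k + 4) -> 'I_l),
    valid_grouping r grp /\ maximally_recoverable H grp.
Proof.
move=> k_gt0 r_gt0 klr m_gt0 /dvdnP[s mE] le_l _ F cardF.
have [grp [idx [grp_idx grpP]]] := balanced_grouping r_gt0 klr.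
have [||P P_indep] := @independent_group_maps F l r s r_gt0.
- by rewrite [(3 * s)%N]mulnC -mE.
(* Since [m = 3s + 1], the factor [2m + s] is [7s + 2]. *)
- rewrite cardF mE mulnK //; congr (2 ^ (r * _))%N; lia.
exists (heavy_mx grp idx P), grp; split=> //.
exact: heavy_mx_maximally_recoverable (card_finPcharP cardF isT) grp_idx P_indep k_gt0.
Qed.
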